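(* Let $R$ be a commutative ring with unit and $d$ a positive integer. Take $G=\mathbb{Z}^d$, $e_i$ the $i$-th standard basis vector, and $S=\mathbb{N}^d$ (with $\mathbb{N}=\{1,2,\dots\}$). With $H^q(\mathbb{N}^d)$ defined in the context, for $0\le q\le d$, $$H^q(\mathbb{N}^d)\cong\begin{cases}R & q=0,\\ 0 & \text{otherwise.}\end{cases}$$
   Context: $\mathcal{A}(\mathbb{N}^d)$ is the ring of all maps $\mathbb{N}^d\to R$. For $f\in\mathcal{A}(\mathbb{N}^d)$, $(\partial_i f)(n)=f(n+e_i)-f(n)$. $\Omega^q(\mathbb{N}^d)$ is the $q$-th exterior power over $\mathcal{A}(\mathbb{N}^d)$ of the free module with basis $dx_1,\dots,dx_d$, so its elements are uniquely $\sum_{i_1<\dots<i_q}f_{i_1\cdots i_q}dx_{i_1}\wedge\cdots\wedge dx_{i_q}$; $\Omega^0=\mathcal{A}(\mathbb{N}^d)$. Maps $D_q:\Omega^{q-1}\to\Omega^q$ ($1\le q\le d$): $D_1f=\sum_i\partial_i f\,dx_i$ and $D_q(\sum f_I\,dx_{i_1}\wedge\cdots\wedge dx_{i_{q-1}})=\sum D_1(f_I)\wedge dx_{i_1}\wedge\cdots\wedge dx_{i_{q-1}}$. Define $H^0(\mathbb{N}^d)=\ker D_1$, $H^q(\mathbb{N}^d)=\ker(D_{q+1})/\operatorname{Im}(D_q)$ for $1\le q\le d-1$, and $H^d(\mathbb{N}^d)=\Omega^d(\mathbb{N}^d)/\operatorname{Im}D_d$. (These are $R$-modules; $\operatorname{Im}D_q\subset\ker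 D_{q+1}$.) *)

(* Defs.v *)
From HB Require Import structures.
From mathcomp Require Import all_boot all_order all_algebra.
From mathcomp Require Import generic_quotient ring_quotient.
From mathcomp Require Import boolp functions.

Set Implicit Arguments.
Unset Strict Implicit.
Unset Printing Implicit Defensive.

Import Order.TTheory GRing.Theory Num.Theory.
Local Open Scope ring_scope.
Local Open Scope quotient_scope.

Definition lmod_iso (R : pzRingType) (U V : lmodType R) : Prop :=
  exists f : {linear U -> V}, bijective f.

Section QuotientModule.
Variables (R : pzRingType) (V : lmodType R) (W : {pred V}).
Hypothesis W_closed : submod_closed W.

Definition submod_pred (_ : submod_closed W) : {pred V} := W.

HB.instance Definition _ := GRing.isZmodClosed.Build V (submod_pred W_closed)
  (GRing.submod_closedB W_closed).

Local Notation Q := (Quotient.quot (submod_pred W_closed)).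

Definition quot_scale (a : R) : Q -> Q := lift_op1 Q (fun v : V => a *: v).

Lemma pi_scale a : {morph \pi_Q : v / a *: v >-> quot_scale a v}.
Proof.
move=> v; unlock quot_scale; apply/eqP.
rewrite -Quotient.idealrBE -scalerBr.
suff: v - repr (\pi_Q v) \in W by move/(GRing.submod_closed_semi W_closed).2; apply.
by have := Quotient.idealrBE (submod_pred W_closed) v (repr (\pi_Q v)); rewrite reprK eqxx.
Qed.

Lemma quot_scaleA a b (v : Q) :
  quot_scale a (quot_scale b v) = quot_scale (a * b) v.
Proof. by elim/quotW: v => v; rewrite -!pi_scale scalerA. Qed.

Lemma quot_scale1 : left_id 1 quot_scale.
Proof. by elim/quotW=> v; rewrite -pi_scale scale1r. Qed.

Lemma quot_scaleDr : right_distributive quot_scale +%R.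
Proof.
by move=> a; elim/quotW=> u; elim/quotW=> v; rewrite -raddfD -!pi_scale -raddfD scalerDr.
Qed.

Lemma quot_scaleDl (v : Q) : {morph quot_scale^~ v : a b / a + b}.
Proof.
by move=> a b; elim/quotW: v => v; rewrite -!pi_scale -raddfD scalerDl.
Qed.

HB.instance Definition _ := GRing.Zmodule_isLmodule.Build R Q
  quot_scaleA quot_scale1 quot_scaleDr quot_scaleDl.

Definition quotmod : lmodType R := Q.

End QuotientModule.

Section KernelImage.
Variables (R : pzRingType) (U V W : lmodType R).
Variables (f : {linear U -> V}) (g : {linear V -> W}).

Definition in_ker : {pred V} := fun v => g v == 0.

Lemma in_ker_closed : submod_closed in_ker.
Proof.
split=> [|a u v]; first by rewrite unfold_in /in_ker raddf0.
by rewrite !unfold_in /in_ker linearP => /eqP-> /eqP->; rewrite scaler0 addr0.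
Qed.

HB.instance Definition _ := GRing.isSubmodClosed.Build R V in_ker in_ker_closed.

Record kernel := Kernel { kernel_val : V; _ : kernel_val \in in_ker }.
HB.instance Definition _ := [isSub for kernel_val].
HB.instance Definition _ := [Choice of kernel by <:].
HB.instance Definition _ := [SubChoice_isSubLmodule of kernel by <:].

Definition ker : lmodType R := kernel.

Definition in_im : {pred V} := fun v => `[< exists u, f u = v >].

Lemma in_im_closed : submod_closed in_im.
Proof.
split=> [|a _ _ /asboolP[u <-] /asboolP[v <-]]; apply/asboolP.
  by exists 0; rewrite raddf0.
by exists (a *: u + v); rewrite linearP.
Qed.

Definition coker : lmodType R := quotmod in_im_closed.

(* [Im f] as a submodule of the type [kernel g]; meant for [g \o f = 0]. *)
Definition in_im_ker : {pred kernel} := fun v => val v \in in_im.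

Lemma in_im_ker_closed : submod_closed in_im_ker.
Proof.
have [im0 imP] := in_im_closed.
split=> [|a u v]; rewrite !unfold_in /in_im_ker; first by rewrite raddf0.
by move=> uI vI; rewrite linearP; apply: imP.
Qed.

Definition ker_mod_im : lmodType R := quotmod in_im_ker_closed.

End KernelImage.

(* [N ^ d] with [N = {1, 2, ...}], as a subset of the group [Z ^ d]. *)
Record Nd (d : nat) := MkNd {
  Nd_val : 'rV[int]_d;
  Nd_gt0 : [forall i, 0 < Nd_val 0 i] }.

Definition basis_vec (d : nat) (i : 'I_d) : 'rV[int]_d := delta_mx 0 i.

Lemma Nd_shift_gt0 (d : nat) (n : Nd d) (i : 'I_d) :
  [forall j, 0 < (Nd_val n + basis_vec i) 0 j].
Proof.
apply/forallP=> j; rewrite !mxE; apply: ltr_pwDl; last by [].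
exact: (forallP (Nd_gt0 n)).
Qed.

Definition Nd_shift (d : nat) (n : Nd d) (i : 'I_d) : Nd d :=
  MkNd (Nd_shift_gt0 n i).

Section Forms.
Variables (R : comPzRingType) (d : nat).

Definition A : Type := Nd d -> R.
HB.instance Definition _ := GRing.ComPzRing.copy A (Nd d -> R).
HB.instance Definition _ := GRing.Lmodule.copy A (Nd d -> R^o).

Definition partial (i : 'I_d) (f : A) : A := fun n => f (Nd_shift n i) - f n.

Definition subset_of_card (q : nat) : Type := {I : {set 'I_d} | #|I| == q}.
HB.instance Definition _ q := SubFinite.on (subset_of_card q).

(* A [q]-form is its family of coefficients [f_I], where [I = {i_1 < ... < i_q}]
   stands for the basis element [dx_{i_1} /\ ... /\ dx_{i_q}]. *)
Definition Omega (q : nat) : Type := {ffun subset_of_card q -> A}.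
HB.instance Definition _ q :=
  GRing.Lmodule.copy (Omega q) {ffun subset_of_card q -> A}.

(* [f dx_{i_1} /\ ... /\ dx_{i_q}] *)
Definition monom (q : nat) (f : A) (I : subset_of_card q) : Omega q :=
  [ffun J => if J == I then f else 0].

Definition singleton (i : 'I_d) : subset_of_card 1 :=
  Sub [set i] (introT eqP (cards1 i)).

(* For disjoint [I] and [J], the sign of the permutation sorting the
   concatenation of the increasing enumerations of [I] and [J]. *)
Definition shuffle_sign (I J : {set 'I_d}) : A :=
  (-1) ^+ #|[set ij : 'I_d * 'I_d | (ij.1 \in I) && (ij.2 \in J) && (ij.2 < ij.1)%N]|.

Definition wedge (p q : nat) (u : Omega p) (v : Omega q) : Omega (p + q) :=
  [ffun K => \sum_(I : subset_of_card p) \sum_(J : subset_of_card q |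
                [disjoint val I & val J] && (val I :|: val J == val K))
              shuffle_sign (val I) (val J) * u I * v J].

Lemma wedge_monom p q f g (I : subset_of_card p) (J : subset_of_card q) K :
  wedge (monom f I) (monom g J) K =
  if [disjoint val I & val J] && (val I :|: val J == val K)
  then shuffle_sign (val I) (val J) * f * g else 0.
Proof.
rewrite ffunE (bigD1 I) //= [X in _ + X]big1 ?addr0 => [|I' /negPf I'I]; last first.
  by apply: big1 => J' _; rewrite ffunE I'I mulr0 mul0r.
rewrite big_mkcond (bigD1 J) //= big1 ?addr0 => [|J' /negPf J'J]; last first.
  by case: ifP => // _; rewrite [monom g J _]ffunE J'J mulr0.
by case: ifP => // _; rewrite !ffunE !eqxx.
Qed.

Lemma wedge_dx_dx i f g : wedge (monom f (singleton i)) (monom g (singleton i)) = 0.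
Proof.
apply/ffunP=> K; rewrite wedge_monom ffunE.
by rewrite disjoints1 /= inE eqxx.
Qed.

(* [dx_i /\ dx_{i_1} /\ ... /\ dx_{i_q}] is a basis element for [i < i_1]. *)
Lemma wedge_dx_monom q (i : 'I_d)
    (I : subset_of_card q) (K : subset_of_card q.+1) :
    (forall j, j \in val I -> (i < j)%N) -> val K = i |: val I ->
  wedge (monom 1 (singleton i)) (monom 1 I) = monom 1 K.
Proof.
move=> lt_iI defK; apply/ffunP=> L; rewrite wedge_monom ffunE disjoints1 /=.
have -> /= : i \notin val I by apply/negP=> /lt_iI; rewrite ltnn.
have -> : (i |: val I == val L) = (L == K).
  by rewrite -defK eq_sym (inj_eq val_inj).
case: (L == K) => //; rewrite !mulr1.
rewrite /shuffle_sign (_ : [set _ | _] = set0) ?cards0 //.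
apply/setP=> -[a b]; rewrite !inE /=; apply/negP=> /andP[/andP[/eqP-> bI]].
by rewrite ltnNge ltnW // lt_iI.
Qed.

Definition D1 (f : A) : Omega 1 := \sum_(i < d) monom (partial i f) (singleton i).

(* [D q] is the map [Omega^q -> Omega^{q+1}], i.e. the operator of index [q+1]. *)
Definition D (q : nat) (w : Omega q) : Omega q.+1 :=
  \sum_(I : subset_of_card q) wedge (D1 (w I)) (monom 1 I).

Lemma partial_is_linear i : linear (partial i).
Proof.
move=> a f g; apply/funext=> n.
by rewrite /partial /= /GRing.add /GRing.scale /= /GRing.scale /= mulrBr opprD addrACA.
Qed.

Lemma monom_is_linear q (I : subset_of_card q) : linear (@monom q ^~ I).
Proof.
move=> a f g; apply/ffunP=> J; rewrite !ffunE.
by case: eqP => _ //; rewrite scaler0 addr0.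
Qed.

Lemma D1_is_linear : linear D1.
Proof.
move=> a f g; rewrite /D1 scaler_sumr -big_split; apply: eq_bigr => i _ /=.
by rewrite partial_is_linear monom_is_linear.
Qed.

Lemma wedge_is_linear p q (v : Omega q) : linear (@wedge p q ^~ v).
Proof.
have scaleMl a (f g : A) : (a *: f) * g = a *: (f * g).
  by apply/funext=> n; apply: esym; apply: mulrA.
move=> a u w; apply/ffunP=> K; rewrite !ffunE scaler_sumr -big_split.
apply: eq_bigr => I _; rewrite scaler_sumr -big_split.
apply: eq_bigr => J _ /=; rewrite !ffunE mulrDr mulrDl; congr (_ + _).
by rewrite -mulrA scaleMl mulrC scaleMl mulrC mulrA.
Qed.

Lemma D_is_linear q : linear (@D q).
Proof.
move=> a u v; rewrite /D scaler_sumr -big_split; apply: eq_bigr => I _ /=.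
by rewrite !ffunE D1_is_linear wedge_is_linear.
Qed.

HB.instance Definition _ q :=
  GRing.isLinear.Build R (Omega q) (Omega q.+1) _ (@D q) (@D_is_linear q).

Definition H (q : nat) : lmodType R :=
  if q is q'.+1 then
    if q == d then coker (@D q') else ker_mod_im (@D q') (@D q'.+1)
  else ker (@D 0).

End Forms.

(* Main.v *)
Require Import Defs.
From HB Require Import structures.
From mathcomp Require Import all_boot all_order all_algebra.
From mathcomp Require Import generic_quotient ring_quotient boolp functions.
From mathcomp Require Import ring.

(** The complex contracts onto its constant functions one coordinate at a time.
    Summation along the [k]-th axis from the face [n_k = 1], combined with the
    contraction of [dx_k], is a homotopy between the identity and the map that
    restricts coefficients to that face and kills [dx_k]. The latter commutes
    with [D], so modulo exact forms a closed form may be replaced by its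
    restriction along every coordinate; this restriction vanishes in positive
    degree. *)

Set Implicit Arguments.
Unset Strict Implicit.
Unset Printing Implicit Defensive.

Import Order.TTheory GRing.Theory Num.Theory.
Local Open Scope ring_scope.

(** * Coordinates of points of the lattice and their unit shifts *)

Section Coordinates.
Variable d : nat.
Implicit Types (n : Nd d) (i k : 'I_d) (m : nat).

Lemma Nd_val_inj : injective (@Nd_val d).
Proof.
move=> [u u_gt0] [v v_gt0] /= eq_uv; case: v / eq_uv v_gt0 => v_gt0.
by rewrite (bool_irrelevance u_gt0 v_gt0).
Qed.

Lemma Nd_ext n n' : (forall i, Nd_val n 0 i = Nd_val n' 0 i) -> n = n'.
Proof. by move=> eqn; apply/Nd_val_inj/rowP. Qed.

Lemma set_coord_gt0 n k m :
  [forall i, 0 < (\row_i (if i == k then m.+1%:Z else Nd_val n 0 i)) 0 i].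
Proof.
by apply/forallP=> i; rewrite mxE; case: eqP => // _; apply: (forallP (Nd_gt0 n)).
Qed.

(* The coordinates of [Nd d] start at [1]: [m] stands for the value [m + 1]. *)
Definition set_coord n k m : Nd d := MkNd (set_coord_gt0 n k m).

(** The number of unit steps along axis [k] from the face [n_k = 1] to [n]. *)
Definition coord_pred n k : nat := (absz (Nd_val n 0 k)).-1.

Lemma coord_predK n k : (coord_pred n k).+1%:Z = Nd_val n 0 k.
Proof.
have := forallP (Nd_gt0 n) k; rewrite /coord_pred.
by case: (Nd_val n 0 k) => // -[].
Qed.

Lemma Nd_shiftE n i j : Nd_val (Nd_shift n i) 0 j = Nd_val n 0 j + (j == i)%:R.
Proof. by rewrite !mxE eqxx. Qed.

Lemma set_coordE n k m j :
  Nd_val (set_coord n k m) 0 j = if j == k then m.+1%:Z else Nd_val n 0 j.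
Proof. by rewrite !mxE. Qed.

Lemma set_coord_id n k : set_coord n k (coord_pred n k) = n.
Proof.
by apply: Nd_ext => j; rewrite set_coordE coord_predK; case: eqP => [->|].
Qed.

Lemma set_coord_shift n k m : set_coord (Nd_shift n k) k m = set_coord n k m.
Proof.
apply: Nd_ext => j; rewrite !set_coordE Nd_shiftE.
by case: eqP => //; rewrite addr0.
Qed.

Lemma shift_set_coord n k m : Nd_shift (set_coord n k m) k = set_coord n k m.+1.
Proof.
apply: Nd_ext => j; rewrite Nd_shiftE !set_coordE.
by case: eqP => _; rewrite ?addr0 // -[in RHS]addn1 PoszD.
Qed.

Lemma set_coord_shiftC n k i m : i != k ->
  set_coord (Nd_shift n i) k m = Nd_shift (set_coord n k m) i.
Proof.
move=> neq_ik; apply: Nd_ext => j; rewrite Nd_shiftE !set_coordE Nd_shiftE.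
by case: eqP => // ->; rewrite eq_sym (negPf neq_ik) addr0.
Qed.

Lemma coord_pred_shift n k : coord_pred (Nd_shift n k) k = (coord_pred n k).+1.
Proof.
have := coord_predK (Nd_shift n k) k; rewrite Nd_shiftE eqxx -coord_predK.
by rewrite -[1%:R]/(1%:Z) -PoszD addn1 => -[].
Qed.

Lemma coord_pred_shiftC n k i : i != k ->
  coord_pred (Nd_shift n i) k = coord_pred n k.
Proof.
by move=> neq_ik; rewrite /coord_pred Nd_shiftE eq_sym (negPf neq_ik) addr0.
Qed.

End Coordinates.

(** * The contracting homotopy on forms of mixed degree *)

Section UngradedForms.
Variables (R : comPzRingType) (d : nat).

(* Forms of mixed degree, so that adding and removing elements of the index set
   needs no cardinality bookkeeping. *)
Definition form : Type := {set 'I_d} -> Nd d -> R.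
Implicit Types (F : form) (K : {set 'I_d}) (n : Nd d) (i k : 'I_d).

Definition nb_below i K : nat := #|[set j in K | (j < i)%N]|.

(** The differential read off at [dx_K]: only the sets [K :\ i] contribute, and the sign comes from
    moving [dx_i] past the smaller indices to its place. *)
Definition form_diff F : form := fun K n =>
  \sum_(i in K) (-1) ^+ nb_below i (K :\ i) *
    (F (K :\ i) (Nd_shift n i) - F (K :\ i) n).

(** The sign brings [dx_k] to the front, where it is contracted. The sum stops just before [n], so
    that its forward difference along [k] is the value at [n] itself. *)
Definition form_int k F : form := fun K n =>
  if k \in K then 0 else
  (-1) ^+ nb_below k K *
    \sum_(0 <= m < coord_pred n k) F (k |: K) (set_coord n k m).

(** Pullback along the projection onto the face [n_k = 1], which sends [dx_k] to zero. *)
Definition form_face k F : form := fun K n =>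
  if k \in K then 0 else F K (set_coord n k 0).

Lemma nb_belowU1 i k K : k \notin K ->
  nb_below i (k |: K) = ((k < i)%N + nb_below i K)%N.
Proof.
move=> kNK; rewrite /nb_below !setIdE setIUl; case: ltnP => lt_ki.
  have -> : [set k] :&: [set j : 'I_d | (j < i)%N] = [set k].
    by apply/setIidPl; rewrite sub1set inE.
  by rewrite cardsU1 !inE negb_and kNK.
have -> : [set k] :&: [set j : 'I_d | (j < i)%N] = set0; last by rewrite set0U.
by apply/setP=> j; rewrite !inE; case: eqP => // ->; rewrite ltnNge lt_ki.
Qed.

(** Contraction of [dx_k] anticommutes with multiplication by [dx_i]: exactly one of [k < i] and
    [i < k] holds, so the two exponents differ by one in total. *)
Lemma sign_swap i k K : i \in K -> k \notin K ->
  (-1) ^+ nb_below k K * (-1) ^+ nb_below i (k |: K :\ i) =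
  - ((-1) ^+ nb_below i (K :\ i) * (-1) ^+ nb_below k (K :\ i)) :> R.
Proof.
move=> iK kNK; have neq_ik : i != k by apply: contraNneq kNK => <-.
rewrite -{1}(setD1K iK) !nb_belowU1 ?inE ?eqxx ?(negPf kNK) ?andbF //.
rewrite !exprD; case: ltngtP => [_|_|/val_inj eq_ik]; last first.
- by rewrite eq_ik eqxx in neq_ik.
- by rewrite /= expr0 expr1; ring.
- by rewrite /= expr0 expr1; ring.
Qed.

Lemma form_homotopy k F K n :
  F K n = form_diff (form_int k F) K n + form_int k (form_diff F) K n +
          form_face k F K n.
Proof.
rewrite {2}/form_int /form_face; case: ifPn => [kK|kNK].
  (* For [i != k] the set [K :\ i] still contains [k], where the integral is zero; only the
     direction [k] remains. *)
  rewrite !addr0 /form_diff (bigD1 k) //= big1 => [|i /andP[iK neq_ik]]; last first.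
    by rewrite /form_int !inE eq_sym neq_ik kK subr0 mulr0.
  rewrite addr0 /form_int !inE eqxx /= setD1K // coord_pred_shift.
  (* The sum up to the shifted point has one more term than the sum up to [n], namely the value at
     [n]. *)
  rewrite big_nat_recr //= set_coord_shift set_coord_id.
  under eq_bigr do rewrite set_coord_shift.
  by rewrite -mulrBr addrAC subrr add0r signrMK.
have kNKi i : k \notin K :\ i by rewrite !inE (negPf kNK) andbF.
have neq_ik i : i \in K -> i != k by move=> iK; apply: contraNneq kNK => <-.
have DkU i : i \in K -> (k |: K) :\ i = k |: K :\ i.
  move=> iK; apply/setP=> j; rewrite !inE.
  by case: (eqVneq j k) => // ->; rewrite eq_sym neq_ik.
(* Shifts along [i != k] leave the summation range unchanged, so the difference passes under the
   sum. *)
have -> : form_diff (form_int k F) K n = \sum_(i in K)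
    (-1) ^+ nb_below i (K :\ i) * (-1) ^+ nb_below k (K :\ i) *
    \sum_(0 <= m < coord_pred n k)
      (F (k |: K :\ i) (Nd_shift (set_coord n k m) i) -
       F (k |: K :\ i) (set_coord n k m)).
  apply: eq_bigr => i iK; rewrite /form_int (negPf (kNKi i)) -mulrA -mulrBr.
  rewrite coord_pred_shiftC ?neq_ik // sumrB.
  by under eq_bigr do rewrite set_coord_shiftC ?neq_ik //.
(* The direction [k] is split off and telescopes to the value at [n] minus the value on the face. *)
have -> : \sum_(0 <= m < coord_pred n k) form_diff F (k |: K) (set_coord n k m) =
    (-1) ^+ nb_below k K * (F K n - F K (set_coord n k 0)) +
    \sum_(i in K) (-1) ^+ nb_below i (k |: K :\ i) *
    \sum_(0 <= m < coord_pred n k)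
      (F (k |: K :\ i) (Nd_shift (set_coord n k m) i) -
       F (k |: K :\ i) (set_coord n k m)).
  under eq_bigr do rewrite /form_diff big_setU1 //= setU1K // shift_set_coord.
  rewrite big_split /= -mulr_sumr telescope_sumr // set_coord_id exchange_big /=.
  by congr (_ + _); apply: eq_bigr => i iK; rewrite DkU // mulr_sumr.
(* The directions [i != k] now cancel pairwise by [sign_swap]. *)
rewrite mulrDr signrMK mulr_sumr addrCA -big_split /= big1.
  by rewrite addr0 subrK.
by move=> i iK; rewrite mulrA sign_swap // -mulrDl subrr mul0r.
Qed.

(** Resetting coordinate [k] commutes with shifts in the other directions and absorbs the shift
    along [k], so no [dx_k] term is created. *)
Lemma form_diff_face k F K n :
  form_diff (form_face k F) K n = form_face k (form_diff F) K n.
Proof.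
rewrite /form_face; case: ifPn => [kK|kNK].
  apply: big1 => i iK; rewrite !inE kK andbT; case: (eqVneq k i) => [<-|_] /=.
    by rewrite set_coord_shift subrr mulr0.
  by rewrite subr0 mulr0.
apply: eq_bigr => i iK; rewrite !inE (negPf kNK) andbF set_coord_shiftC //.
by apply: contraNneq kNK => <-.
Qed.

End UngradedForms.

(** * Transfer to forms of fixed degree, and exactness in positive degree *)

Section GradedForms.
Variables (R : comPzRingType) (d : nat).

Definition form_of q (w : Omega R d q) : form R d := fun K n =>
  if insub K is Some J then w J n else 0.

Definition of_form q (F : form R d) : Omega R d q := [ffun I => F (val I)].

Lemma form_of_val q (w : Omega R d q) (I : subset_of_card d q) n :
  form_of w (val I) n = w I n.
Proof. by rewrite /form_of valK. Qed.

Lemma form_of_card q (w : Omega R d q) (K : {set _}) n : #|K| != q -> form_of w K n = 0.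
Proof. by move=> neqK; rewrite /form_of insubN. Qed.

Lemma form_of_of_form q (F : form R d) :
  (forall (K : {set _}) n, #|K| != q -> F K n = 0) -> form_of (of_form q F) = F.
Proof.
move=> F0; apply/funext=> K; apply/funext=> n; rewrite /form_of.
by case: insubP => [I _ <-|/F0->//]; rewrite ffunE.
Qed.

Lemma form_of_inj q : injective (@form_of q).
Proof.
move=> u v eq_uv; apply/ffunP=> I; apply/funext=> n.
by rewrite -!form_of_val eq_uv.
Qed.

Lemma form_of0 q K n : form_of (0 : Omega R d q) K n = 0.
Proof. by rewrite /form_of; case: insubP => // I _ _; rewrite ffunE. Qed.

Lemma form_ofD q (u v : Omega R d q) K n :
  form_of (u + v) K n = form_of u K n + form_of v K n.
Proof.
by rewrite /form_of; case: insubP => [I _ _|]; rewrite ?addr0 // ffunE.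
Qed.

Lemma shuffle_sign1 i (I : {set 'I_d}) n :
  shuffle_sign R [set i] I n = (-1) ^+ nb_below i I.
Proof.
rewrite /shuffle_sign.
have -> : [set ij : 'I_d * 'I_d | (ij.1 \in [set i]) && (ij.2 \in I) &&
      (ij.2 < ij.1)%N] = [set (i, j) | j in [set j in I | (j < i)%N]].
  apply/setP=> -[a b]; rewrite !inE /=; apply/idP/imsetP.
    by case/andP=> /andP[/eqP-> bI] lt_ba; exists b; rewrite // inE bI.
  by case=> j; rewrite inE => /andP[jI lt_ji] [-> ->]; rewrite eqxx jI.
rewrite card_imset => [|a b [] //]; rewrite -/(nb_below i I).
(* The left-hand sign is a power in the ring of functions; the induction evaluates it at [n]. *)
by elim: (nb_below i I) => [|m IHm]; rewrite ?expr0 // !exprS -IHm.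
Qed.

(** Carries the homotopy over to [D]: in the sum over [i] and [I], the coefficient at [K] receives
    for each [i] in [K] the single term with [I = K :\ i]. *)
Lemma form_of_D q (w : Omega R d q) : form_of (D w) = form_diff (form_of w).
Proof.
apply/funext=> K; apply/funext=> n.
have [cardK|neqK] := eqVneq #|K| q.+1; last first.
  rewrite form_of_card // /form_diff big1 // => i iK.
  have neqKi : #|K :\ i| != q.
    by apply: contraNneq neqK => <-; rewrite (cardsD1 i K) iK.
  by rewrite !form_of_card // subrr mulr0.
pose J : subset_of_card d q.+1 := Sub K (introT eqP cardK).
have evalD p (L : subset_of_card d p) :
  {morph (fun v : Omega R d p => v L n) : u v / u + v}.
  by move=> u v; rewrite ffunE.
have eval0 p (L : subset_of_card d p) : (0 : Omega R d p) L n = 0.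
  by rewrite ffunE.
rewrite -[K in LHS]/(val J) form_of_val /D (big_morph _ (evalD _ J) (eval0 _ J)).
have wedge0 (I : subset_of_card d q) : wedge (0 : Omega R d 1) (monom 1 I) = 0.
  apply/ffunP=> L; rewrite !ffunE big1 // => I' _; rewrite big1 // => J' _.
  by rewrite ffunE mulr0 mul0r.
have wedgeD (I : subset_of_card d q) :
    {morph (fun v : Omega R d 1 => wedge v (monom 1 I)) : u v / u + v}.
  move=> u v; have := wedge_is_linear (monom 1 I) 1 u v.
  by rewrite !scale1r.
have wedgeJ f i (I : subset_of_card d q) :
    (wedge (monom f (singleton i)) (monom 1 I) : Omega R d q.+1) J n =
    (if (i \notin val I) && (i |: val I == K)
     then shuffle_sign R [set i] (val I) * f * 1 else 0) n.
  rewrite -disjoints1; exact: (congr1 (@^~ n) (wedge_monom f 1 (singleton i) I J)).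
under eq_bigr => I _.
  rewrite /D1 (big_morph _ (wedgeD I) (wedge0 I)) (big_morph _ (evalD _ J) (eval0 _ J)).
  under eq_bigr do rewrite wedgeJ.
  over.
rewrite exchange_big /= /form_diff [RHS]big_mkcond /=; apply: eq_bigr => i _.
case: ifPn => [iK|iNK]; last first.
  apply: big1 => I _; case: ifP => // /andP[_ /eqP eqK].
  by rewrite -eqK !inE eqxx in iNK.
have cardKi : #|K :\ i| == q by rewrite -eqSS -cardK (cardsD1 i K) iK.
pose I0 : subset_of_card d q := Sub (K :\ i) cardKi.
rewrite (bigD1 I0) //= big1 => [|I neqI]; last first.
  case: ifP => // /andP[iNI /eqP eqK]; case/eqP: neqI; apply: val_inj => /=.
  by rewrite -eqK setU1K.
rewrite addr0 !inE eqxx /= setD1K // eqxx.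
by rewrite -[K :\ i]/(val I0) !form_of_val -(shuffle_sign1 _ _ n) mulr1.
Qed.

(** Induction on [s], with one application of the homotopy per coordinate; the exact parts
    accumulate in [u]. *)
Lemma closed_mod_exact_face q (w : Omega R d q.+1) (s : seq 'I_d) : D w = 0 ->
  exists (u : Omega R d q) (v : Omega R d q.+1), [/\ w = D u + v, D v = 0 &
    forall (K : {set 'I_d}) n, has (fun k => k \in K) s -> form_of v K n = 0].
Proof.
move=> Dw; elim: s => [|k s [u [v [eqw Dv v0]]]].
  by exists 0, w; rewrite linear0 add0r.
pose hv := of_form q (form_int k (form_of v)).
pose pv := of_form q.+1 (form_face k (form_of v)).
have hvE : form_of hv = form_int k (form_of v).
  apply: form_of_of_form => K n neqK; rewrite /form_int; case: ifPn => // kNK.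
  by rewrite big1 ?mulr0 // => m _; rewrite form_of_card // cardsU1 kNK.
have pvE : form_of pv = form_face k (form_of v).
  apply: form_of_of_form => K n neqK; rewrite /form_face; case: ifPn => // kNK.
  by rewrite form_of_card.
have dv0 K n : form_diff (form_of v) K n = 0 by rewrite -form_of_D Dv form_of0.
exists (u + hv), pv; split.
(* Since [v] is closed, the homotopy formula reduces to [v = D hv + pv]. *)
- rewrite linearD -addrA eqw; congr (_ + _); apply: form_of_inj.
  apply/funext=> K; apply/funext=> n; rewrite form_ofD form_of_D hvE pvE.
  rewrite [LHS](form_homotopy k) {2}/form_int.
  by under eq_bigr do rewrite dv0; rewrite big1 // mulr0 if_same addr0.
- apply: form_of_inj; apply/funext=> K; apply/funext=> n.
  by rewrite form_of_D pvE form_diff_face /form_face dv0 form_of0 if_same.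
(* Sets containing [k] are killed by the new restriction; elsewhere it only moves the evaluation
   point, which preserves the earlier vanishing. *)
move=> K n /=; rewrite pvE /form_face; case: ifP => //= _.
exact: v0.
Qed.

(** After restriction along all coordinates only the coefficient at the empty set could survive, and
    it is absent in positive degree. *)
Lemma closed_exact q (w : Omega R d q.+1) : D w = 0 -> exists u, D u = w.
Proof.
move=> /(closed_mod_exact_face (enum 'I_d)) [u [v [-> _ v0]]]; exists u.
suff -> : v = 0 by rewrite addr0.
apply: form_of_inj; apply/funext=> K; apply/funext=> n; rewrite form_of0.
have [->|[i iK]] := set_0Vmem K; first by rewrite form_of_card // cards0.
by apply: v0; apply/hasP; exists i; rewrite ?mem_enum.
Qed.

Lemma top_form_closed (w : Omega R d d) : D w = 0.
Proof.
(* An index of [D w] would be a subset of ['I_d] with [d + 1] elements. *)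
apply/ffunP=> I; have := max_card (mem (val I)).
by rewrite card_ord (eqP (valP I)) ltnn.
Qed.

(** * Degree zero: closed functions are constant *)

Lemma card_set0 : #|(set0 : {set 'I_d})| == 0%N.
Proof. by rewrite cards0. Qed.

Definition empty_index : subset_of_card d 0 := Sub set0 card_set0.

Lemma empty_indexE (I : subset_of_card d 0) : I = empty_index.
Proof. by apply: val_inj; apply/eqP; rewrite /= -cards_eq0 (valP I). Qed.

Lemma form_diff1 (F : form R d) i n :
  form_diff F [set i] n = F set0 (Nd_shift n i) - F set0 n.
Proof.
rewrite /form_diff big_set1 setDv (_ : nb_below i set0 = 0%N) ?mul1r //.
by apply/eqP; rewrite cards_eq0; apply/eqP/setP=> j; rewrite !inE.
Qed.

Lemma closed0_shift (w : Omega R d 0) n i : D w = 0 ->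
  w empty_index (Nd_shift n i) = w empty_index n.
Proof.
move=> Dw; apply/eqP; rewrite -subr_eq0 -!form_of_val /=; apply/eqP.
by rewrite -form_diff1 -form_of_D Dw form_of0.
Qed.

Lemma closed0_set_coord (w : Omega R d 0) n k m : D w = 0 ->
  w empty_index (set_coord n k m) = w empty_index n.
Proof.
move=> Dw; rewrite -[in RHS](set_coord_id n k).
have to0 l : w empty_index (set_coord n k l) = w empty_index (set_coord n k 0).
  by elim: l => // l IHl; rewrite -shift_set_coord closed0_shift.
by rewrite !to0.
Qed.

(** Resetting all coordinates to [1] joins any two points to a common one without changing the value
    of [w]. *)
Lemma closed0_const (w : Omega R d 0) n n' : D w = 0 ->
  w empty_index n = w empty_index n'.
Proof.
move=> Dw; pose ones := foldr (fun k (p : Nd d) => set_coord p k 0).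
have w_ones p s : w empty_index (ones p s) = w empty_index p.
  by elim: s => //= k s IHs; rewrite closed0_set_coord.
rewrite -(w_ones n (enum 'I_d)) -(w_ones n' (enum 'I_d)); congr (w _ _).
have onesE p s i : i \in s -> Nd_val (ones p s) 0 i = 1.
  elim: s => //= k s IHs; rewrite inE set_coordE.
  by case: eqP => //= _ /IHs.
by apply: Nd_ext => i; rewrite !onesE ?mem_enum.
Qed.

Lemma const_closed (a : R) : D (of_form 0 (fun _ _ => a)) = 0.
Proof.
apply: form_of_inj; apply/funext=> K; apply/funext=> n; rewrite form_of_D form_of0.
apply: big1 => i iK; rewrite /form_of; case: insubP => [I _ _|_].
  by rewrite !ffunE subrr mulr0.
by rewrite subrr mulr0.
Qed.

Lemma one_point_gt0 : [forall i, 0 < (const_mx 1 : 'rV[int]_d) 0 i].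
Proof. by apply/forallP=> i; rewrite mxE. Qed.

Definition ev1 (w : ker (@D R d 0)) : R^o :=
  (val w : Omega R d 0) empty_index (MkNd one_point_gt0).

Lemma ev1_is_linear : linear ev1.
Proof. by move=> a u v; rewrite /ev1 linearP !ffunE. Qed.

HB.instance Definition _ :=
  GRing.isLinear.Build R (ker (@D R d 0)) R^o _ ev1 ev1_is_linear.

(** Evaluation at the point [(1, ..., 1)] is inverted by the constant functions. *)
Lemma ker_D0_iso : lmod_iso (ker (@D R d 0)) R^o.
Proof.
exists ev1; have inK a : of_form 0 (fun _ _ => a) \in in_ker (@D R d 0).
  by apply/eqP/const_closed.
exists (fun a => Kernel (inK a)) => [w|a]; last by rewrite /= /ev1 /= ffunE.
apply: val_inj; apply/ffunP=> I; apply/funext=> n; rewrite /= ffunE.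
rewrite (empty_indexE I); apply: closed0_const; exact/eqP/(valP w).
Qed.

End GradedForms.

(** * Identification of the cohomology modules *)

Lemma lmod_iso_rV0 (R : pzRingType) (V : lmodType R) :
  (forall v : V, v = 0) -> lmod_iso V 'rV[R]_0.
Proof.
move=> V0; exists (GRing.null_fun 'rV[R]_0 : {linear V -> 'rV[R]_0}).
by exists (fun _ => 0) => v; [rewrite (V0 v) | rewrite [v]thinmx0].
Qed.

Lemma quotmod_eq0 (R : pzRingType) (V : lmodType R) (W : {pred V})
    (W_closed : submod_closed W) :
  (forall v, v \in W) -> forall x : quotmod W_closed, x = 0.
Proof.
move=> VW; elim/quotW=> v; rewrite -(raddf0 (\pi_(quotmod W_closed))%qT).
by apply/eqP; rewrite -Quotient.idealrBE; apply: VW.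
Qed.

Theorem theorem2 (R : comPzRingType) (d : nat) (d_gt0 : (0 < d)%N)
    (q : nat) (q_le_d : (q <= d)%N) :
  lmod_iso (H R d q)
    (if q == 0%N then (R^o : lmodType R) else ('rV[R]_0 : lmodType R)).
Proof.
case: q q_le_d => [_|q _]; first exact: ker_D0_iso.
(* Both quotients vanish because every closed form is exact; in top degree every form is closed. *)
rewrite /H /=; case: ifP => [/eqP eq_d|_]; apply/lmod_iso_rV0/quotmod_eq0.
  case: d / eq_d {d_gt0} => w; apply/asboolP/closed_exact/top_form_closed.
by move=> w; apply/asboolP/closed_exact/eqP/(valP w).
Qed.
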